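(* Fix an integer $i\geq 6$ and the data used to construct the groups $T_{\mathcal{P}}$ (as described in the context). The map defined by $\mathcal{P}\mapsto T_{\mathcal{P}}$ is a functor from the category of countable group presentations $\operatorname{Pres}$ to the category of groups $\operatorname{Grp}$.
   Context: Notation: $\pi_1(\langle\mathbf{x};\mathbf{r}\rangle)=F(\mathbf{x})/\langle\langle\mathbf{r}\rangle\rangle$, where $\langle\langle\mathbf{r}\rangle\rangle$ is the normal closure of $\mathbf{r}$ in $F(\mathbf{x})$. A countable group presentation is one with $|\mathbf{x}|\leq|\mathbb{N}|$. For a group $H$, a proper subgroup $K\lneq H$ and $\phi\in\operatorname{Aut}(H)$, put $H\ast_{(K,\phi)}=\langle H,t;\ tkt^{-1}=\phi(k),\ k\in K\rangle$ (the automorphism-induced HNN-extension). A subgroup $M\leq H$ is malcharacteristic in $H$ if for all $\delta\in\operatorname{Aut}(H)$: $\delta(M)\cap M\neq 1$ implies $\delta\in\operatorname{Inn}(M):=\{\gamma_h: h\in M\}$, where $\gamma_h(g)=h^{-1}gh$ for $g\in H$. Construction of $T_{\mathcal{P}}$. Let $T_i=\langle a,b;\ a^i,b^i,(ab)^i\rangle$ and let $\phi\in\operatorname{Aut}(T_i)$ be the automorphism $a\mapsto b$, $b\mapsto b^{-1}a^{-1}$. For each $n\in\mathbb{N}\cup\{\infty\}$ (where $\infty=|\mathbb{N}|$) fix a malcharacteristic subgroup $M_n$ of $T_i$ which is free of rank $n$ (such subgroups exist). Given $\mathcal{P}=\langle\mathbf{x};\mathbf{r}\rangle$, put $\widehat{\mathbf{x}}=\mathbf{x}\sqcup\{p,q\}$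 and $\widehat{\mathbf{r}}=\mathbf{r}\sqcup\{p,q\}$, where $p,q$ are new letters, and identify $F(\widehat{\mathbf{x}})$ with $M_{|\widehat{\mathbf{x}}|}$ via an isomorphism fixed once and for all for each $\mathbf{x}$. Let $K_{\mathcal{P}}\leq M_{|\widehat{\mathbf{x}}|}$ be the subgroup corresponding to the normal closure $\langle\langle\widehat{\mathbf{r}}\rangle\rangle$ of $\widehat{\mathbf{r}}$ in $F(\widehat{\mathbf{x}})$. Then $T_{\mathcal{P}}:=T_i\ast_{(K_{\mathcal{P}},\phi)}$. The category $\operatorname{Pres}$. Say $\langle\mathbf{y};\mathbf{s}\rangle$ is a quotient presentation of $\langle\mathbf{x};\mathbf{r}\rangle$ if $\mathbf{x}=\mathbf{y}$ and $\langle\langle\mathbf{r}\rangle\rangle\lneq\langle\langle\mathbf{s}\rangle\rangle$; write $\langle\mathbf{x};\mathbf{r}\rangle\sim\langle\mathbf{y};\mathbf{s}\rangle$ if $\mathbf{x}=\mathbf{y}$ and $\langle\langle\mathbf{r}\rangle\rangle=\langle\langle\mathbf{s}\rangle\rangle$. The category $\operatorname{Pres}_{\mathbf{x}}$ has as objects the presentations with generating set $\mathbf{x}$, up to $\sim$, and, besides identities, a unique morphism $\mathcal{P}_j\to\mathcal{P}_k$ whenever $\mathcal{P}_k$ is a quotient presentation of $\mathcal{P}_j$ (so $\operatorname{Pres}_{\mathbf{x}}$ is isomorphic to the poset of normal subgroups of $F(\mathbf{x})$ under inclusion). Up to isomorphism $\operatorname{Pres}_{\mathbf{x}}$ depends only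 on $n=|\mathbf{x}|$, and is denoted $\operatorname{Pres}_n$ (concretely, one may take one fixed generating set $\mathbf{x}$ of each cardinality $n$). $\operatorname{Pres}$ is the (disjoint) union of the categories $\operatorname{Pres}_n$, $n\in\mathbb{N}\cup\{\infty\}$, with $0\notin\mathbb{N}$. On morphisms, the functor sends $\mathcal{P}_j\to\mathcal{P}_k$ to the surjective homomorphism $T_{\mathcal{P}_j}\to T_{\mathcal{P}_k}$ which is the identity on $T_i$ and sends $t$ to $t$. *)

(* Defs.v *)
From HB Require Import structures.
From mathcomp Require Import all_boot ssralg ssrnum ssrint.
From mathcomp Require Import boolp classical_sets functions.

Set Implicit Arguments.
Unset Strict Implicit.
Unset Printing Implicit Defensive.

Import GRing.Theory Num.Theory.

Local Open Scope classical_set_scope.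
Local Open Scope group_scope.
Local Open Scope quotient_scope.

(* For groups, preserving multiplication is enough to preserve 1 (lemma morph1). *)
Notation "{ 'ghom' G -> H }" := (UMagmaMorphism.type G%type H%type)
  (at level 0, G at level 98, H at level 99, format "{ 'ghom'  G  ->  H }") : type_scope.

Lemma morph1 (G H : groupType) (f : G -> H) : {morph f : x y / x * y} -> f 1 = 1.
Proof. by move=> fM; apply: (@mulgI _ (f 1)); rewrite -fM !mulg1. Qed.

Section Subgroups.
Variable G : groupType.

Definition is_subgroup (K : set G) : Prop :=
  K 1 /\ forall x y, K x -> K y -> K (x * y^-1).

Definition is_normal_subgroup (N : set G) : Prop :=
  is_subgroup N /\ forall x g, N x -> N (x ^ g).

Definition normal_closure (R : set G) : set G := smallest is_normal_subgroup R.

Lemma normal_closure_normal R : is_normal_subgroup (normal_closure R).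
Proof.
split; first split.
- by move=> N [[[]]].
- move=> x y Kx Ky N NR; have [[[_ NM] _] _] := NR.
  by apply: NM; [exact: Kx | exact: Ky].
- by move=> x g Kx N NR; have [[_ NJ] _] := NR; apply: NJ; exact: Kx.
Qed.

Lemma sub_normal_closure R : R `<=` normal_closure R.
Proof. exact: sub_smallest. Qed.

Lemma normal_closure1 R : normal_closure R 1.
Proof. by have [[]] := normal_closure_normal R. Qed.

Lemma normal_closureV R x : normal_closure R x -> normal_closure R x^-1.
Proof.
have [[N1 NM] _] := normal_closure_normal R.
by move=> Nx; rewrite -[x^-1]mul1g; apply: NM.
Qed.

Lemma normal_closureM R x y :
  normal_closure R x -> normal_closure R y -> normal_closure R (x * y).
Proof.
have [[N1 NM] _] := normal_closure_normal R.
move=> Nx Ny; rewrite -[y]invgK; apply: NM => //.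
exact: normal_closureV.
Qed.

Lemma normal_closureJ R x g : normal_closure R x -> normal_closure R (x ^ g).
Proof. by have [_] := normal_closure_normal R; apply. Qed.

Record proper_subgroup := ProperSubgroup {
  psub_set : set G;
  psub_subgroup : is_subgroup psub_set;
  psub_proper : psub_set `<` [set: G]
}.

Record Aut := MkAut {
  aut_fun :> {ghom G -> G};
  aut_bij : bijective aut_fun
}.

(* The elements of Inn(M) are the maps g |-> g ^ h = h^-1 * (g * h), h in M. *)
Definition is_Inn (M : set G) (delta : Aut) : Prop :=
  exists2 h, M h & forall g, delta g = g ^ h.

Definition malcharacteristic (M : set G) : Prop :=
  forall delta : Aut,
    (delta @` M) `&` M <> [set 1] -> is_Inn M delta.

End Subgroups.

Section Quotient.
Variables (G : groupType) (R : set G).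

Definition nc_rel : rel G := fun x y => `[< normal_closure R (x^-1 * y) >].

Lemma nc_refl : reflexive nc_rel.
Proof. by move=> x; apply/asboolP; rewrite mulVg; exact: normal_closure1. Qed.

Lemma nc_sym : symmetric nc_rel.
Proof.
move=> x y; apply/asboolP/asboolP => /normal_closureV;
  by rewrite invgM invgK.
Qed.

Lemma nc_trans : transitive nc_rel.
Proof.
move=> y x z /asboolP xy /asboolP yz; apply/asboolP.
have -> : x^-1 * z = (x^-1 * y) * (y^-1 * z) by rewrite -mulgA mulVKg.
exact: normal_closureM.
Qed.

Canonical nc_equiv := EquivRel nc_rel nc_refl nc_sym nc_trans.

(* G / <<R>> *)
Definition nquot := {eq_quot nc_equiv}.
HB.instance Definition _ := Choice.on nquot.
HB.instance Definition _ := Quotient.on nquot.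

Definition nquot_pi (x : G) : nquot := \pi_nquot x.

Lemma nquot_piP x y :
  nquot_pi x = nquot_pi y <-> normal_closure R (x^-1 * y).
Proof.
split; first by move/eqmodP/asboolP.
by move=> ?; apply/eqmodP/asboolP.
Qed.

Lemma nquot_repr x : normal_closure R (x^-1 * repr (nquot_pi x)).
Proof. by apply/nquot_piP; rewrite /nquot_pi reprK. Qed.

Definition nquot_mul (x y : nquot) : nquot := nquot_pi (repr x * repr y).
Definition nquot_inv (x : nquot) : nquot := nquot_pi (repr x)^-1.

Lemma nquot_mul_pi x y : nquot_mul (nquot_pi x) (nquot_pi y) = nquot_pi (x * y).
Proof.
apply/esym/nquot_piP.
set x' := repr _; set y' := repr _.
have -> : (x * y)^-1 * (x' * y') = (x^-1 * x') ^ y * (y^-1 * y').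
  by rewrite conjgE invgM !mulgA mulgK.
apply: normal_closureM; last exact: nquot_repr.
by apply: normal_closureJ; exact: nquot_repr.
Qed.

Lemma nquot_inv_pi x : nquot_inv (nquot_pi x) = nquot_pi x^-1.
Proof.
apply/nquot_piP; rewrite invgK.
set x' := repr _.
have -> : x' * x^-1 = (x^-1 * x') ^ x^-1.
  by rewrite conjgE invgK !mulgA mulgV mul1g.
by apply: normal_closureJ; exact: nquot_repr.
Qed.

Lemma nquot_ind (P : nquot -> Prop) :
  (forall x, P (nquot_pi x)) -> forall x, P x.
Proof. by move=> h x; rewrite -[x]reprK; exact: h. Qed.

Lemma nquot_mulA : associative nquot_mul.
Proof.
elim/nquot_ind => x; elim/nquot_ind => y; elim/nquot_ind => z.
by rewrite !nquot_mul_pi mulgA.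
Qed.

Lemma nquot_mul1 : left_id (nquot_pi 1) nquot_mul.
Proof. by elim/nquot_ind => x; rewrite nquot_mul_pi mul1g. Qed.

Lemma nquot_mulr1 : right_id (nquot_pi 1) nquot_mul.
Proof. by elim/nquot_ind => x; rewrite nquot_mul_pi mulg1. Qed.

Lemma nquot_mulV : left_inverse (nquot_pi 1) nquot_inv nquot_mul.
Proof. by elim/nquot_ind => x; rewrite nquot_inv_pi nquot_mul_pi mulVg. Qed.

Lemma nquot_mulVr : right_inverse (nquot_pi 1) nquot_inv nquot_mul.
Proof. by elim/nquot_ind => x; rewrite nquot_inv_pi nquot_mul_pi mulgV. Qed.

HB.instance Definition _ := isGroup.Build nquot
  nquot_mulA nquot_mul1 nquot_mulr1 nquot_mulV nquot_mulVr.

Lemma nquot_pi_is_multiplicative : {morph nquot_pi : x y / x * y}.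
Proof. by move=> x y; rewrite -nquot_mul_pi. Qed.
HB.instance Definition _ :=
  isMultiplicative.Build G nquot nquot_pi nquot_pi_is_multiplicative.
HB.instance Definition _ :=
  Multiplicative_isUMagmaMorphism.Build G nquot nquot_pi (morph1 nquot_pi_is_multiplicative).

Section Lift.
Variables (H : groupType) (f : {ghom G -> H}).
Hypothesis fR : forall x, R x -> f x = 1.

Lemma nquot_lift_ker x : normal_closure R x -> f x = 1.
Proof.
move=> Nx; apply: (Nx [set x | f x = 1]); split; last exact: fR.
split; first split.
- exact: gmulf1.
- by move=> y z /= fy fz; rewrite gmulfM gmulfV fy fz invg1 mulg1.
- by move=> y g /= fy; rewrite conjgE !gmulfM fy mul1g gmulfV mulVg.
Qed.

Definition nquot_lift (x : nquot) : H := f (repr x).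

Lemma nquot_liftE x : nquot_lift (nquot_pi x) = f x.
Proof.
have := nquot_lift_ker (nquot_repr x); rewrite gmulfM gmulfV => e.
by rewrite /nquot_lift -[LHS](mulVKg (f x)) e mulg1.
Qed.

Lemma nquot_lift_is_multiplicative : {morph nquot_lift : x y / x * y}.
Proof.
elim/nquot_ind => x; elim/nquot_ind => y.
by rewrite -gmulfM !nquot_liftE gmulfM.
Qed.
End Lift.

End Quotient.

Section FreeGroup.
Variable X : choiceType.

(* (x, false) is the letter x and (x, true) its formal inverse. *)
Definition letter_inv (l : X * bool) : X * bool := (l.1, ~~ l.2).

Lemma letter_invK : involutive letter_inv.
Proof. by case=> x b; rewrite /letter_inv /= negbK. Qed.

Definition reduced (w : seq (X * bool)) : bool :=
  sorted (fun l m => m != letter_inv l) w.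

Record free_group := FreeGroup {
  fg_word :> seq (X * bool);
  fg_reduced : reduced fg_word
}.

HB.instance Definition _ := [isSub for fg_word].
HB.instance Definition _ := [Choice of free_group by <:].

Definition push (l : X * bool) (w : seq (X * bool)) : seq (X * bool) :=
  if w is m :: w' then if m == letter_inv l then w' else l :: w else [:: l].

Definition free_concat (u v : seq (X * bool)) : seq (X * bool) := foldr push v u.

Lemma push_reduced l w : reduced w -> reduced (push l w).
Proof.
case: w => //= m w; case: ifP => [_ /path_sorted //| ml pw].
by rewrite /reduced /= ml.
Qed.

Lemma pushK l w : reduced w -> push l (push (letter_inv l) w) = w.
Proof.
case: w => [|m w] /=; first by rewrite eqxx.
rewrite letter_invK; case: eqP => [-> | ml] //=; last by rewrite eqxx.
by case: w => [|k w] //=; rewrite /reduced /= => /andP[/negPf->].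
Qed.

Lemma free_concat_reduced u v : reduced v -> reduced (free_concat u v).
Proof. by move=> rv; elim: u => //= l u IH; exact: push_reduced. Qed.

Lemma free_concat_push l v w : reduced w ->
  free_concat (push l v) w = push l (free_concat v w).
Proof.
move=> rw; case: v => [|m v] //=; case: eqP => [->|//].
by rewrite pushK //; exact: free_concat_reduced.
Qed.

Lemma free_concatA u v w : reduced w ->
  free_concat u (free_concat v w) = free_concat (free_concat u v) w.
Proof. by move=> rw; elim: u => //= l u ->; rewrite free_concat_push. Qed.

Lemma free_concatw0 u : reduced u -> free_concat u [::] = u.
Proof.
elim: u => //= l u IH ru; rewrite IH; last exact: path_sorted ru.
by case: u ru {IH} => //= m u; rewrite /reduced /= => /andP[/negPf->].
Qed.

Definition word_inv (u : seq (X * bool)) := rev (map letter_inv u).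

Lemma word_invK : involutive word_inv.
Proof. by move=> u; rewrite /word_inv map_rev revK mapK //; exact: letter_invK. Qed.

Lemma word_inv_reduced u : reduced u -> reduced (word_inv u).
Proof.
rewrite /reduced /word_inv rev_sorted sorted_map.
apply: sub_sorted => l m /=; apply: contra => /eqP e.
by rewrite -[m]letter_invK -e.
Qed.

Lemma free_concatV u : free_concat (word_inv u) u = [::].
Proof.
elim: u => //= l u IH.
rewrite /word_inv /= rev_cons /free_concat foldr_rcons /= letter_invK eqxx.
exact: IH.
Qed.

Definition fg_mul (u v : free_group) : free_group :=
  FreeGroup (free_concat_reduced u (fg_reduced v)).
Definition fg_one : free_group := @FreeGroup [::] isT.
Definition fg_inv (u : free_group) : free_group :=
  FreeGroup (word_inv_reduced (fg_reduced u)).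

Lemma fg_mulA : associative fg_mul.
Proof. by move=> u v w; apply/val_inj/free_concatA; exact: fg_reduced. Qed.
Lemma fg_mul1 : left_id fg_one fg_mul.
Proof. by move=> u; exact/val_inj. Qed.
Lemma fg_mulr1 : right_id fg_one fg_mul.
Proof. by move=> u; apply/val_inj/free_concatw0; exact: fg_reduced. Qed.
Lemma fg_mulV : left_inverse fg_one fg_inv fg_mul.
Proof. by move=> u; apply/val_inj/free_concatV. Qed.
Lemma fg_mulVr : right_inverse fg_one fg_inv fg_mul.
Proof.
move=> u; have e : fg_inv (fg_inv u) = u by apply/val_inj/word_invK.
by rewrite -{1}e fg_mulV.
Qed.

HB.instance Definition _ := isGroup.Build free_group
  fg_mulA fg_mul1 fg_mulr1 fg_mulV fg_mulVr.

Definition fg_gen (x : X) : free_group := @FreeGroup [:: (x, false)] isT.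

Section Lift.
Variables (H : groupType) (f : X -> H).

Definition letter_val (l : X * bool) : H := if l.2 then (f l.1)^-1 else f l.1.
Definition word_val (w : seq (X * bool)) : H :=
  foldr (fun l h => letter_val l * h) 1 w.
Definition fg_lift (w : free_group) : H := word_val w.

Lemma word_val_push l w : word_val (push l w) = letter_val l * word_val w.
Proof.
case: w => //= m w; case: eqP => //= ->; rewrite mulgA.
suff -> : letter_val l * letter_val (letter_inv l) = 1 by rewrite mul1g.
by rewrite /letter_val /letter_inv /=; case: l.2; rewrite /= ?mulVg ?mulgV.
Qed.

Lemma fg_lift_is_multiplicative : {morph fg_lift : u v / u * v}.
Proof.
move=> [u ru] [v rv]; rewrite /fg_lift /= /free_concat => {ru}.
elim: u => [|l u IH] /=; first by rewrite mul1g.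
by rewrite word_val_push IH mulgA.
Qed.
HB.instance Definition _ :=
  isMultiplicative.Build free_group H fg_lift fg_lift_is_multiplicative.
HB.instance Definition _ :=
  Multiplicative_isUMagmaMorphism.Build free_group H fg_lift (morph1 fg_lift_is_multiplicative).

Lemma fg_lift_gen x : fg_lift (fg_gen x) = f x.
Proof. by rewrite /fg_lift /= mulg1. Qed.
End Lift.

Lemma fg_ind (P : free_group -> Prop) :
  P 1 -> (forall x u, P u -> P (fg_gen x * u)) ->
  (forall x u, P u -> P ((fg_gen x)^-1 * u)) -> forall u, P u.
Proof.
move=> P1 Pg PV [u ru]; elim: u ru => [|[x b] u IH] ru.
  by have -> : FreeGroup ru = 1 by exact/val_inj.
have ru' : reduced u by exact: path_sorted ru.
suff -> : FreeGroup ru =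
    (if b then (fg_gen x)^-1 else fg_gen x) * FreeGroup ru'.
  by case: b ru => ru; [apply: PV | apply: Pg]; exact: IH.
apply: val_inj; case: b ru => /=; case: u {IH ru'} => //= m u;
  by rewrite /reduced /= => /andP[/negPf->].
Qed.

End FreeGroup.

(* Presentations with generating set X: the relators form a set of elements of
   F(X). *)
Definition presentation (X : choiceType) : Type := set (free_group X).

Definition pi1 (X : choiceType) (r : presentation X) : groupType := nquot r.

Arguments fg_lift : simpl never.
Arguments nquot_pi : simpl never.

Section HNN.
Variables (H : groupType) (K : proper_subgroup H) (phi : Aut H).

(* The generators are the elements of H (via Some) and the stable letter None;
   the first family of relators is the multiplication table of H. *)
Definition hnn_relators : presentation (option H) :=
  [set w | exists g h, w = fg_gen (Some g) * fg_gen (Some h) *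
                           (fg_gen (Some (g * h)))^-1] `|`
  [set w | exists2 k, psub_set K k & w = fg_gen None * fg_gen (Some k) *
                           (fg_gen None)^-1 * (fg_gen (Some (phi k)))^-1].

Definition hnn : groupType := pi1 hnn_relators.

Definition hnn_base (h : H) : hnn := nquot_pi hnn_relators (fg_gen (Some h)).
Definition hnn_t : hnn := nquot_pi hnn_relators (fg_gen None).

End HNN.

Section Triangle.
Variable i : nat.

(* Generators a = false and b = true. *)
Definition tri_relators : presentation bool :=
  [set fg_gen false ^+ i; fg_gen true ^+ i; (fg_gen false * fg_gen true) ^+ i].

Definition triangle : groupType := pi1 tri_relators.

Definition tri_a : triangle := nquot_pi tri_relators (fg_gen false).
Definition tri_b : triangle := nquot_pi tri_relators (fg_gen true).

Lemma tri_expa : tri_a ^+ i = 1.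
Proof.
rewrite /tri_a -gmulfXn; apply/esym/nquot_piP.
by rewrite invg1 mul1g; apply: sub_normal_closure; left; left.
Qed.

Lemma tri_expb : tri_b ^+ i = 1.
Proof.
rewrite /tri_b -gmulfXn; apply/esym/nquot_piP.
by rewrite invg1 mul1g; apply: sub_normal_closure; left; right.
Qed.

Lemma tri_expab : (tri_a * tri_b) ^+ i = 1.
Proof.
rewrite /tri_a /tri_b -gmulfM -gmulfXn; apply/esym/nquot_piP.
by rewrite invg1 mul1g; apply: sub_normal_closure; right.
Qed.

Lemma tri_ind (P : triangle -> Prop) :
  P 1 -> (forall x, P x -> P (tri_a * x)) -> (forall x, P x -> P (tri_b * x)) ->
  (forall x, P x -> P (tri_a^-1 * x)) -> (forall x, P x -> P (tri_b^-1 * x)) ->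
  forall x, P x.
Proof.
move=> P1 Pa Pb PaV PbV; elim/nquot_ind; elim/fg_ind.
- by rewrite gmulf1.
- by move=> [] u Pu; rewrite gmulfM; [apply: Pb | apply: Pa].
- by move=> [] u Pu; rewrite gmulfM gmulfV; [apply: PbV | apply: PaV].
Qed.

Definition tri_phi_gen (x : bool) : triangle :=
  if x then tri_b^-1 * tri_a^-1 else tri_b.

Lemma tri_phi_rel w : tri_relators w -> fg_lift tri_phi_gen w = 1.
Proof.
case=> [[]|] ->; rewrite gmulfXn /= ?gmulfM /= !fg_lift_gen /=.
- exact: tri_expb.
- by rewrite -invgM expVgn tri_expab invg1.
- by rewrite mulVKg expVgn tri_expa invg1.
Qed.

Definition tri_phi_fun : triangle -> triangle :=
  @nquot_lift _ tri_relators _ (fg_lift tri_phi_gen).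

HB.instance Definition _ := isMultiplicative.Build triangle triangle
  tri_phi_fun (nquot_lift_is_multiplicative tri_phi_rel).
HB.instance Definition _ := Multiplicative_isUMagmaMorphism.Build triangle triangle
  tri_phi_fun (morph1 (nquot_lift_is_multiplicative tri_phi_rel)).

Lemma tri_phi_a : tri_phi_fun tri_a = tri_b.
Proof.
by rewrite /tri_phi_fun /tri_a (nquot_liftE tri_phi_rel) /= fg_lift_gen.
Qed.

Lemma tri_phi_b : tri_phi_fun tri_b = tri_b^-1 * tri_a^-1.
Proof.
by rewrite /tri_phi_fun /tri_b (nquot_liftE tri_phi_rel) /= fg_lift_gen.
Qed.

Arguments tri_phi_fun : simpl never.

Lemma tri_phi3 x : tri_phi_fun (tri_phi_fun (tri_phi_fun x)) = x.
Proof.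
have ea : tri_phi_fun (tri_phi_fun (tri_phi_fun tri_a)) = tri_a.
  by rewrite tri_phi_a tri_phi_b gmulfM /= !gmulfV /= tri_phi_a tri_phi_b
    invgM !invgK mulgK.
have eb : tri_phi_fun (tri_phi_fun (tri_phi_fun tri_b)) = tri_b.
  by rewrite -tri_phi_a ea.
by elim/tri_ind: x => [|x e|x e|x e|x e];
  rewrite /= ?gmulf1 //= !gmulfM /= ?gmulfV /= ?e ?ea ?eb.
Qed.

Lemma tri_phi_bij : bijective tri_phi_fun.
Proof.
by exists (tri_phi_fun \o tri_phi_fun) => x /=; exact: tri_phi3.
Qed.

Definition tri_phi : Aut triangle := MkAut tri_phi_bij.

End Triangle.

(* The cardinals in {1, 2, ...} u {oo}. *)
Variant rank := Fin (n : nat) of (0 < n)%N | Infty.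

Definition rank_add2 (n : rank) : rank :=
  if n is @Fin k _ then @Fin k.+2 isT else Infty.

(* One fixed generating set of each cardinality. *)
Definition gens (n : rank) : choiceType :=
  match n with @Fin k _ => 'I_k | Infty => nat end.

Definition is_free_of_rank (G : groupType) (M : set G) (n : rank) : Prop :=
  exists f : {ghom free_group (gens n) -> G},
    injective f /\ f @` setT = M.

Definition hat (X : choiceType) : choiceType := (X + bool)%type.

Section Hat.
Variable X : choiceType.

Definition hat_p : free_group (hat X) := fg_gen (inr false : hat X).
Definition hat_q : free_group (hat X) := fg_gen (inr true : hat X).

Definition hat_incl : free_group X -> free_group (hat X) :=
  fg_lift (fun x : X => fg_gen (inl x : hat X)).

Definition hat_relators (r : presentation X) : presentation (hat X) :=
  (hat_incl @` r) `|` [set hat_p; hat_q].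

End Hat.

(* [ident n] identifies F(x u {p, q}), for x of cardinality n, with the chosen
   free malcharacteristic subgroup [mal] of rank n + 2 (where oo + 2 = oo). *)
Record construction_data (i : nat) := ConstructionData {
  mal : rank -> set (triangle i);
  mal_subgroup : forall n, is_subgroup (mal n);
  mal_malcharacteristic : forall n, malcharacteristic (mal n);
  mal_free : forall n, is_free_of_rank (mal n) n;
  ident : forall n, {ghom free_group (hat (gens n)) -> triangle i};
  ident_inj : forall n, injective (ident n);
  ident_image : forall n, ident n @` setT = mal (rank_add2 n)
}.

(* Z written multiplicatively, the target of the exponent-sum map. *)
Definition mint : Type := int.
HB.instance Definition _ := Choice.on mint.
HB.instance Definition _ := @isGroup.Build mint
  (0%R : int) (@GRing.opp int) (@GRing.add int)
  (@addrA int) (@add0r int) (@addr0 int) (@addNr int) (@addrN int).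

Section Construction.
Variables (i : nat) (hi : (6 <= i)%N) (D : construction_data i) (n : rank).

Definition K_set (P : presentation (gens n)) : set (triangle i) :=
  ident D n @` normal_closure (hat_relators P).

Lemma K_subgroup P : is_subgroup (K_set P).
Proof.
have [[N1 NM] _] := normal_closure_normal (hat_relators P).
split; first by exists 1 => //; rewrite gmulf1.
move=> _ _ [x Nx <-] [y Ny <-]; exists (x * y^-1); first exact: NM.
by rewrite gmulfM gmulfV.
Qed.

Lemma mint_expg (x : mint) k : x ^+ k = (x *+ k : int)%R.
Proof.
by elim: k => [|k IH] //; rewrite expgS IH mulrS.
Qed.

Lemma ident_not_surjective : ~ (forall g, exists w, ident D n w = g).
Proof.
move=> surj.
pose e : {ghom free_group (hat (gens n)) -> mint} :=
  fg_lift (fun _ : hat (gens n) => (1%R : int) : mint).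
have tors w : ident D n w ^+ i = 1 -> e w = 1.
  rewrite -gmulfXn -(@gmulf1 _ _ (ident D n)) => /(@ident_inj _ D n) w1.
  have /eqP : e w ^+ i = 1 by rewrite -gmulfXn w1 gmulf1.
  by rewrite mint_expg mulrn_eq0; case: i hi => //= ? _ /eqP.
have e1 : forall g w, ident D n w = g -> e w = 1.
  have step a g : a ^+ i = 1 ->
      (forall w, ident D n w = g -> e w = 1) ->
      forall w, ident D n w = a * g -> e w = 1.
    move=> ai IH w wg; have [v va] := surj a.
    have -> : w = v * (v^-1 * w) by rewrite mulVKg.
    rewrite gmulfM (IH (v^-1 * w)); last by rewrite gmulfM gmulfV va wg mulKg.
    by rewrite mulg1; apply: tors; rewrite va.
  elim/tri_ind => [w w1|g|g|g|g].
  - by apply: tors; rewrite w1 expg1n.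
  - by apply: step; exact: tri_expa.
  - by apply: step; exact: tri_expb.
  - by apply: step; rewrite expVgn tri_expa invg1.
  - by apply: step; rewrite expVgn tri_expb invg1.
by have := e1 _ (hat_p (gens n)) erefl; rewrite /e /= fg_lift_gen.
Qed.

Lemma K_proper P : K_set P `<` [set: triangle i].
Proof.
split=> // sub; apply: ident_not_surjective => g.
by have [w _ <-] := sub g I; exists w.
Qed.

Definition K_sub (P : presentation (gens n)) : proper_subgroup (triangle i) :=
  ProperSubgroup (K_subgroup P) (K_proper P).

Definition T_group (P : presentation (gens n)) : groupType :=
  hnn (K_sub P) (tri_phi i).

Definition T_base (P : presentation (gens n)) : triangle i -> T_group P :=
  @hnn_base _ (K_sub P) (tri_phi i).

Definition T_t (P : presentation (gens n)) : T_group P :=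
  hnn_t (K_sub P) (tri_phi i).

Definition canonical_surjection (P Q : presentation (gens n))
    (g : {ghom T_group P -> T_group Q}) : Prop :=
  [/\ forall h, g (T_base P h) = T_base Q h,
      g (T_t P) = T_t Q &
      forall y, exists x, g x = y].

End Construction.

Record category := Category {
  Ob : Type;
  Hom : Ob -> Ob -> Type;
  idc : forall A, Hom A A;
  compc : forall A B C, Hom B C -> Hom A B -> Hom A C;
  compc1 : forall A B (f : Hom A B), compc f (idc A) = f;
  comp1c : forall A B (f : Hom A B), compc (idc B) f = f;
  compcA : forall A B C D (h : Hom C D) (g : Hom B C) (f : Hom A B),
    compc h (compc g f) = compc (compc h g) f
}.
Arguments Hom {c} _ _.
Arguments idc {c} A.
Arguments compc {c A B C} _ _.

Record functor (C D : category) := Functor {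
  fob : Ob C -> Ob D;
  fhom : forall A B, Hom A B -> Hom (fob A) (fob B);
  fhom_id : forall A, fhom (idc A) = idc (fob A);
  fhom_comp : forall A B E (g : Hom B E) (f : Hom A B),
    fhom (compc g f) = compc (fhom g) (fhom f)
}.
Arguments fhom {C D} _ {A B} _.

Definition cast_hom (C : category) (A A' B B' : Ob C) (eA : A = A') (eB : B = B')
    (f : Hom A B) : Hom A' B' :=
  ecast X (Hom A' X) eB (ecast X (Hom X B) eA f).

Section GrpCategory.

(* A [groupType] carries a choice operator on its underlying set; under the
   axiom of choice every group has one, and morphisms ignore it. *)
Definition grp_hom (G H : groupType) : Type := {ghom G -> H}.

Lemma grp_hom_eq (G H : groupType) (f g : grp_hom G H) : f =1 g -> f = g.
Proof.
case: f g => [f [[pf] [qf]]] [g [[pg] [qg]]] /= /funext fg; subst g.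
by rewrite (Prop_irrelevance pf pg) (Prop_irrelevance qf qg).
Qed.

Definition grp_id (G : groupType) : grp_hom G G := idfun.
Definition grp_comp (G H K : groupType) (g : grp_hom H K) (f : grp_hom G H) :
  grp_hom G K := g \o f.

Lemma grp_comp1 (G H : groupType) (f : grp_hom G H) :
  grp_comp f (grp_id G) = f.
Proof. exact: grp_hom_eq. Qed.
Lemma grp_1comp (G H : groupType) (f : grp_hom G H) :
  grp_comp (grp_id H) f = f.
Proof. exact: grp_hom_eq. Qed.
Lemma grp_compA (G H K L : groupType) (h : grp_hom K L) (g : grp_hom H K)
  (f : grp_hom G H) : grp_comp h (grp_comp g f) = grp_comp (grp_comp h g) f.
Proof. exact: grp_hom_eq. Qed.

Definition Grp : category := Category grp_comp1 grp_1comp grp_compA.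

End GrpCategory.

Section PresX.
Variable X : choiceType.

Definition quotient_presentation (s r : presentation X) : Prop :=
  normal_closure r `<` normal_closure s.

Definition pres_rel : rel (presentation X) :=
  fun r s => `[< normal_closure r = normal_closure s >].

Lemma pres_refl : reflexive pres_rel.
Proof. by move=> r; apply/asboolP. Qed.
Lemma pres_sym : symmetric pres_rel.
Proof. by move=> r s; apply/asboolP/asboolP. Qed.
Lemma pres_trans : transitive pres_rel.
Proof. by move=> s r t /asboolP rs /asboolP st; apply/asboolP; rewrite rs. Qed.

Canonical pres_equiv := EquivRel pres_rel pres_refl pres_sym pres_trans.

Definition pres_class := {eq_quot pres_equiv}.

Definition class_of (r : presentation X) : pres_class := \pi_pres_class r.

Lemma class_ofP r s : class_of r = class_of s <-> normal_closure r = normal_closure s.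
Proof.
split; first by move/eqmodP/asboolP.
by move=> ?; apply/eqmodP/asboolP.
Qed.

Definition quotient_class (c d : pres_class) : Prop :=
  exists r s, [/\ c = class_of r, d = class_of s & quotient_presentation s r].

(* A proposition, hence with at most one proof: the identities, and one
   morphism for each quotient presentation. *)
Definition pres_hom (c d : pres_class) : Prop := c = d \/ quotient_class c d.

Lemma pres_id c : pres_hom c c. Proof. by left. Qed.

Lemma pres_comp c d e : pres_hom d e -> pres_hom c d -> pres_hom c e.
Proof.
move=> [<- // | [r [s [dr es rs]]]] [-> | [r' [s' [cr ds rs']]]].
  by right; exists r, s.
right; exists r', s; split => //.
move: ds; rewrite dr => /class_ofP e1.
case: rs' rs => rs' _; rewrite /quotient_presentation e1 => -[ss nss].
by split; [exact: subset_trans rs' ss | move=> h; apply: nss; exact: subset_trans h rs'].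
Qed.

Definition Pres_on : category :=
  @Category pres_class pres_hom pres_id pres_comp
    (fun _ _ _ => Prop_irrelevance _ _) (fun _ _ _ => Prop_irrelevance _ _)
    (fun _ _ _ _ _ _ _ => Prop_irrelevance _ _).

End PresX.

Section DisjointUnion.
Variables (I : Type) (C : I -> category).

Definition du_ob : Type := {n : I & Ob (C n)}.

Definition du_hom (x y : du_ob) : Type :=
  {e : projT1 x = projT1 y &
     Hom (ecast n (Ob (C n)) e (projT2 x)) (projT2 y)}.

Definition du_id (x : du_ob) : du_hom x x := existT _ erefl (idc (projT2 x)).

Definition du_comp (x y z : du_ob) (g : du_hom y z) (f : du_hom x y) :
  du_hom x z.
Proof.
case: x y z g f => [n x] [m y] [k z] [/= e g] [/= e' f].
by destruct e, e'; exists erefl; exact: compc g f.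
Defined.

Lemma du_comp1 x y (f : du_hom x y) : du_comp f (du_id x) = f.
Proof.
by case: x y f => [n x] [m y] [/= e f]; destruct e; rewrite /= compc1.
Qed.

Lemma du_1comp x y (f : du_hom x y) : du_comp (du_id y) f = f.
Proof.
by case: x y f => [n x] [m y] [/= e f]; destruct e; rewrite /= comp1c.
Qed.

Lemma du_compA x y z t (h : du_hom z t) (g : du_hom y z) (f : du_hom x y) :
  du_comp h (du_comp g f) = du_comp (du_comp h g) f.
Proof.
case: x y z t h g f => [n x] [m y] [k z] [l t] [/= e3 h] [/= e2 g] [/= e1 f].
by destruct e1, e2, e3; rewrite /= compcA.
Qed.

Definition disjoint_union : category := Category du_comp1 du_1comp du_compA.

End DisjointUnion.

Definition Pres : category := disjoint_union (fun n : rank => Pres_on (gens n)).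

Definition pres_ob (n : rank) (P : presentation (gens n)) : Ob Pres :=
  existT (fun n => Ob (Pres_on (gens n))) n (class_of P).

(* Main.v *)
Require Import Defs.
From HB Require Import structures.
From mathcomp Require Import all_boot.
From mathcomp Require Import boolp classical_sets.

(** An inclusion K <= K' of proper subgroups of H makes every HNN-relation
[t k t^-1 = phi k] of [hnn K phi] a relation of [hnn K' phi], so the universal
property of the HNN-extension ([hnn_lift]) gives a homomorphism [hnn_map] that
is the identity on H and on t.  As H and t generate ([hnn_ind]), this
homomorphism is onto and is the only one with these values ([hnn_hom_eq]);
functoriality in K for inclusions follows from that uniqueness.

It remains to see that [P |-> K_P] is a monotone map on the poset underlying
[Pres].  A morphism from the class of r to the class of s says that
<<r>> <= <<s>>, and this inclusion passes to the closures of the enlarged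
relator sets ([normal_closure_hat]): the preimage of <<hat s>> under
F(x) -> F(x u {p, q}) is normal and contains s, hence contains r.  In
particular equivalent presentations have equal subgroups K_P, so K_P depends
only on the class.

Objects of [Pres] are classes, so the functor is evaluated at a representative
and its value is only propositionally equal to T_P.  The functor is therefore
factored through the type of proper subgroups of the triangle group: there the
equality is one between subgroups, and transporting [hnn_map] along it yields
[hnn_map] again ([cast_hnn_map]). *)

Set Implicit Arguments.
Unset Strict Implicit.
Unset Printing Implicit Defensive.

Local Open Scope classical_set_scope.
Local Open Scope group_scope.

(** * Normal closures *)

Lemma normal_closure_min (G : groupType) (R N : set G) :
  is_normal_subgroup N -> R `<=` N -> normal_closure R `<=` N.
Proof. by move=> nN RN x; apply. Qed.

Lemma preimage_normal (G H : groupType) (f : {ghom G -> H}) (N : set H) :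
  is_normal_subgroup N -> is_normal_subgroup (f @^-1` N).
Proof.
move=> [[N1 NM] NJ]; split; first split.
- by rewrite /= gmulf1.
- by move=> x y /= Nx Ny; rewrite gmulfM gmulfV; apply: NM.
- by move=> x g /= Nx; rewrite conjgE !gmulfM gmulfV -conjgE; apply: NJ.
Qed.

(** Both closures are compared inside F(x u {p, q}), but the hypothesis lives in
F(x); pulling the larger one back along [hat_incl] gives a normal subgroup of
F(x) containing s, hence all of <<s>> and in particular r. *)
Lemma normal_closure_hat (X : choiceType) (r s : presentation X) :
  normal_closure r `<=` normal_closure s ->
  normal_closure (hat_relators r) `<=` normal_closure (hat_relators s).
Proof.
move=> rs; apply: normal_closure_min; first exact: normal_closure_normal.
have pres w : normal_closure s w -> normal_closure (hat_relators s) (hat_incl w).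
  (* [hat_incl] is unfolded so that its homomorphism structure is found. *)
  apply: (@normal_closure_min _ s
    ((fg_lift (fun x : X => fg_gen (inl x : hat X)))
       @^-1` normal_closure (hat_relators s))).
    exact/preimage_normal/normal_closure_normal.
  by move=> v sv; apply: sub_normal_closure; left; exists v.
move=> v [[w rw <-] | pq].
  by apply: pres; apply: rs; exact: sub_normal_closure.
by apply: sub_normal_closure; right.
Qed.

(** * Homomorphisms out of an HNN-extension *)

Section HNNUniversal.
Variables (H : groupType) (phi : Aut H).

Section Base.
Variable K : proper_subgroup H.

Lemma hnn_baseM : {morph hnn_base K phi : x y / x * y}.
Proof.
move=> x y; rewrite /hnn_base -gmulfM; apply/esym/nquot_piP.
have conj_inv (u v : free_group (option H)) : u^-1 * v = (u * v^-1)^-1 ^ u.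
  by rewrite conjgE invgM invgK mulgVK.
(* The relators are [g * h * (g * h)^-1] whereas equality of cosets is phrased
   with [u^-1 * v]; the two differ by inversion and a conjugation. *)
rewrite conj_inv; apply: normal_closureJ; apply: normal_closureV.
by apply: sub_normal_closure; left; exists x, y.
Qed.

HB.instance Definition _ :=
  isMultiplicative.Build H (hnn K phi) (hnn_base K phi) hnn_baseM.
HB.instance Definition _ := Multiplicative_isUMagmaMorphism.Build H (hnn K phi)
  (hnn_base K phi) (morph1 hnn_baseM).

Lemma hnn_tJ k : psub_set K k ->
  hnn_t K phi * hnn_base K phi k * (hnn_t K phi)^-1 = hnn_base K phi (phi k).
Proof.
move=> Kk; apply: divg1_eq.
transitivity (nquot_pi (hnn_relators K phi) (fg_gen None * fg_gen (Some k) *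
    (fg_gen None)^-1 * (fg_gen (Some (phi k)))^-1)).
  by rewrite !gmulfM !gmulfV.
apply/esym/nquot_piP; rewrite invg1 mul1g.
by apply: sub_normal_closure; right; exists k.
Qed.

Lemma hnn_ind (S : hnn K phi -> Prop) :
  S 1 -> (forall x y, S x -> S y -> S (x * y)) -> (forall x, S x -> S x^-1) ->
  (forall h, S (hnn_base K phi h)) -> S (hnn_t K phi) -> forall x, S x.
Proof.
move=> S1 SM SV Sb St; elim/nquot_ind; elim/fg_ind; first by rewrite gmulf1.
- by case=> [h|] u Su; rewrite gmulfM; apply: SM => //; apply: Sb.
- by case=> [h|] u Su; rewrite gmulfM gmulfV; apply: SM => //; apply: SV => //;
    apply: Sb.
Qed.

Lemma hnn_hom_eq (L : groupType) (f g : grp_hom (hnn K phi) L) :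
  (forall h, f (hnn_base K phi h) = g (hnn_base K phi h)) ->
  f (hnn_t K phi) = g (hnn_t K phi) -> f = g.
Proof.
move=> eb et; apply: grp_hom_eq; elim/hnn_ind => //.
- by rewrite !gmulf1.
- by move=> x y ex ey; rewrite !gmulfM ex ey.
- by move=> x ex; rewrite !gmulfV ex.
Qed.

Section Lift.
Variables (L : groupType) (u : {ghom H -> L}) (s : L).
Hypothesis sJ : forall k, psub_set K k -> s * u k * s^-1 = u (phi k).

Let gen_val (o : option H) : L := if o is Some h then u h else s.

Lemma hnn_lift_rel w : hnn_relators K phi w -> fg_lift gen_val w = 1.
Proof.
by case=> [[g [h ->]] | [k Kk ->]]; rewrite !gmulfM !gmulfV /= !fg_lift_gen /=
  ?gmulfM ?sJ // mulgV.
Qed.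

Definition hnn_lift_fun : hnn K phi -> L :=
  @nquot_lift _ (hnn_relators K phi) _ (fg_lift gen_val).

HB.instance Definition _ := isMultiplicative.Build (hnn K phi) L hnn_lift_fun
  (nquot_lift_is_multiplicative hnn_lift_rel).
HB.instance Definition _ := Multiplicative_isUMagmaMorphism.Build (hnn K phi) L
  hnn_lift_fun (morph1 (nquot_lift_is_multiplicative hnn_lift_rel)).

Definition hnn_lift : grp_hom (hnn K phi) L := hnn_lift_fun.

Lemma hnn_lift_base h : hnn_lift (hnn_base K phi h) = u h.
Proof. by rewrite [LHS](nquot_liftE hnn_lift_rel) /= fg_lift_gen. Qed.

Lemma hnn_lift_t : hnn_lift (hnn_t K phi) = s.
Proof. by rewrite [LHS](nquot_liftE hnn_lift_rel) /= fg_lift_gen. Qed.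

End Lift.

End Base.

(** * Functoriality in the associated subgroup *)

Section Map.
Variables (K K' : proper_subgroup H) (sub : psub_set K `<=` psub_set K').

Definition hnn_map : grp_hom (hnn K phi) (hnn K' phi) :=
  hnn_lift (u := hnn_base K' phi) (fun k Kk => hnn_tJ (sub Kk)).

Lemma hnn_map_base h : hnn_map (hnn_base K phi h) = hnn_base K' phi h.
Proof. exact: hnn_lift_base. Qed.

Lemma hnn_map_t : hnn_map (hnn_t K phi) = hnn_t K' phi.
Proof. exact: hnn_lift_t. Qed.

Lemma hnn_map_surj y : exists x, hnn_map x = y.
Proof.
elim/hnn_ind: y.
- by exists 1; rewrite gmulf1.
- by move=> _ _ [x <-] [y <-]; exists (x * y); rewrite gmulfM.
- by move=> _ [x <-]; exists x^-1; rewrite gmulfV.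
- by move=> h; exists (hnn_base K phi h); exact: hnn_map_base.
- by exists (hnn_t K phi); exact: hnn_map_t.
Qed.

End Map.

Lemma hnn_map_id (K : proper_subgroup H) (sub : psub_set K `<=` psub_set K) :
  hnn_map sub = grp_id (hnn K phi).
Proof.
by apply: hnn_hom_eq => [h|]; [exact: hnn_map_base | exact: hnn_map_t].
Qed.

Lemma hnn_map_comp (K1 K2 K3 : proper_subgroup H)
    (s12 : psub_set K1 `<=` psub_set K2) (s23 : psub_set K2 `<=` psub_set K3)
    (s13 : psub_set K1 `<=` psub_set K3) :
  hnn_map s13 = grp_comp (hnn_map s23) (hnn_map s12).
Proof.
apply: hnn_hom_eq => [h|].
  by rewrite /grp_comp /= !hnn_map_base.
by rewrite /grp_comp /= !hnn_map_t.
Qed.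

(** Transport of a homomorphism along equalities of groups is intractable in
general; when the equalities come from equalities of associated subgroups,
these can be eliminated, and the two inclusions become proofs of the same
proposition. *)
Lemma cast_hnn_map (K1 K1' K2 K2' : proper_subgroup H) (e1 : K1 = K1')
    (e2 : K2 = K2') (s : psub_set K1 `<=` psub_set K2)
    (s' : psub_set K1' `<=` psub_set K2') :
  @cast_hom Grp _ _ _ _ (congr1 (fun K => hnn K phi) e1)
    (congr1 (fun K => hnn K phi) e2) (hnn_map s) = hnn_map s'.
Proof. by destruct e1, e2; rewrite (Prop_irrelevance s s'). Qed.

End HNNUniversal.

(** * The associated subgroup of a presentation *)

Lemma proper_subgroup_eq (G : groupType) (K K' : proper_subgroup G) :
  psub_set K = psub_set K' -> K = K'.
Proof.
case: K K' => [K sK pK] [K' sK' pK'] /= e; destruct e.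
by rewrite (Prop_irrelevance sK sK') (Prop_irrelevance pK pK').
Qed.

Lemma normal_closure_repr (X : choiceType) (r : presentation X) :
  normal_closure (repr (class_of r)) = normal_closure r.
Proof. by apply/class_ofP; exact: reprK. Qed.

Lemma pres_hom_sub (X : choiceType) (c d : pres_class X) :
  pres_hom c d -> normal_closure (repr c) `<=` normal_closure (repr d).
Proof.
case=> [-> // | [r [s [-> -> [rs _]]]]].
by rewrite !normal_closure_repr.
Qed.

Section Functor.
Variables (i : nat) (hi : (6 <= i)%N) (D : construction_data i).

Lemma K_set_sub n (P Q : presentation (gens n)) :
  normal_closure P `<=` normal_closure Q -> K_set D P `<=` K_set D Q.
Proof. by move=> PQ; apply: image_subset; exact: normal_closure_hat. Qed.

(** The object map of the functor before HNN-extensions are formed.  Its values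
lie in a type that does not mention the rank, so that morphisms of [Pres]
can be handled without transport between different generating sets. *)
Definition K_class (x : Ob Pres) : proper_subgroup (triangle i) :=
  K_sub hi D (repr (projT2 x : pres_class (gens (projT1 x)))).

(** The representative of the class of P may differ from P, but K_P only depends
on the normal closure of P. *)
Lemma K_class_ob n (P : presentation (gens n)) :
  K_class (pres_ob P) = K_sub hi D P.
Proof.
apply: proper_subgroup_eq; rewrite /= eqEsubset.
by split; apply: K_set_sub; rewrite normal_closure_repr.
Qed.

Lemma K_class_sub (x y : Ob Pres) :
  Hom x y -> psub_set (K_class x) `<=` psub_set (K_class y).
Proof.
case: x y => [n c] [m d] [/= e f]; destruct e.
by apply: K_set_sub; exact: pres_hom_sub.
Qed.

Definition T_functor : functor Pres Grp :=
  @Functor Pres Grp (fun x => hnn (K_class x) (tri_phi i))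
    (fun x y f => hnn_map (tri_phi i) (K_class_sub f))
    (fun x => hnn_map_id (tri_phi i) (K_class_sub (idc x)))
    (fun x y z g f => hnn_map_comp (tri_phi i) (K_class_sub f) (K_class_sub g)
                        (K_class_sub (compc g f))).

End Functor.

Theorem theorem2 (i : nat) (hi : (6 <= i)%N) (D : construction_data i) :
  exists (F : functor Pres Grp)
         (eF : forall (n : rank) (P : presentation (gens n)),
                 fob F (pres_ob P) = T_group hi D P),
    forall (n : rank) (P Q : presentation (gens n))
           (f : Hom (pres_ob P) (pres_ob Q)),
      canonical_surjection (cast_hom (eF n P) (eF n Q) (fhom F f)).
Proof.
exists (T_functor hi D).
exists (fun n P => congr1 (fun K => hnn K (tri_phi i)) (K_class_ob hi D P)).
move=> n P Q f.
have sub : psub_set (K_sub hi D P) `<=` psub_set (K_sub hi D Q).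
  by rewrite -!K_class_ob; exact: K_class_sub.
rewrite (cast_hnn_map _ _ _ (K_class_sub f) sub).
split; [exact: hnn_map_base | exact: hnn_map_t | exact: hnn_map_surj].
Qed.
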